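(* Let $A$ be a finite set of positive real numbers. Then \[ |A+A|^2\,|A/A| \ge \frac{|A|^4}{4}. \] Consequently, \[ \max\big\{|A+A|,\,|A/A|\big\} \ge \frac{|A|^{4/3}}{2}. \]
   Context: For a finite set $A$ of positive real numbers, the sum-set is $A+A=\{a+b : a,b\in A\}$ and the ratio-set is $A/A=\{a/b : a,b\in A\}$. $|X|$ denotes the cardinality of a finite set $X$. *)

(* Defs.v *)
From mathcomp Require Import all_boot all_order all_algebra.
From mathcomp Require Import finmap.

Set Implicit Arguments.
Unset Strict Implicit.
Unset Printing Implicit Defensive.

Local Open Scope ring_scope.

Definition sumset (R : fieldType) (A : {fset R}) : {fset R} :=
  [fset (a + b)%R | a : R in A, b : R in A]%fset.

Definition ratioset (R : fieldType) (A : {fset R}) : {fset R} :=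
  [fset (a / b)%R | a : R in A, b : R in A]%fset.

(* Main.v *)
(** Solymosi's argument with popular ratios. View [A * A] as a set of points in
    the plane: the [|A|^2] points lie on the [|A/A|] lines through the origin
    whose slopes are in [A/A]. At least half of them lie on popular lines,
    those carrying at least [|A|^2 / (2 |A/A|)] points. The vector sums of the
    points of two consecutive popular lines are pairwise distinct and lie in
    the open sector between these lines, so different pairs of lines yield
    disjoint sets of points of [(A+A) * (A+A)]. The steepest popular line is
    instead paired with its own projection to the vertical line through
    [min A], which yields points on or above it. *)
Require Import Defs.
From mathcomp Require Import all_boot all_order all_algebra.
From mathcomp Require Import finmap.
From mathcomp Require Import reals exp.
From mathcomp Require Import lra zify.

Set Implicit Arguments.
Unset Strict Implicit.
Unset Printing Implicit Defensive.

Import Order.TTheory GRing.Theory Num.Theory.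
Local Open Scope ring_scope.

(** Serves both geometric bounds: [f] sends two abscissas to a vector sum, and [p] is the planar
    region holding these sums. *)
Lemma leq_mul_count (S T : choiceType) (U : eqType) (A : {fset S}) (B : {fset T})
    (f : S -> T -> U) (p : pred U) (s : seq U) :
    (forall a b, a \in A -> b \in B -> (f a b \in s) && p (f a b)) ->
    (forall a b a' b', f a b = f a' b' -> (a, b) = (a', b')) ->
  (#|` A | * #|` B | <= count p s)%N.
Proof.
move=> fAB f_inj; rewrite -(size_allpairs f) -size_filter.
apply: uniq_leq_size.
  by apply: allpairs_uniq => // -[a b] [a' b'] _ _ /f_inj.
by move=> _ /allpairsP[[a b] [/= aA bB ->]]; rewrite mem_filter andbC fAB.
Qed.

(* The abscissas of the points of [A * A] on the line of slope [l]. *)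
Definition line (R : fieldType) (A : {fset R}) (l : R) : {fset R} :=
  [fset a in A | l * a \in A]%fset.

Lemma in_line (R : fieldType) (A : {fset R}) (l a : R) :
  (a \in line A l) = (a \in A) && (l * a \in A).
Proof. by rewrite !inE. Qed.

Definition sumgrid (R : fieldType) (A : {fset R}) : seq (R * R) :=
  [seq (x, y) | x <- sumset A, y <- sumset A].

Lemma size_sumgrid (R : fieldType) (A : {fset R}) :
  size (sumgrid A) = (#|` sumset A | ^ 2)%N.
Proof. by rewrite size_allpairs mulnn. Qed.

Lemma mem_sumgrid (R : fieldType) (A : {fset R}) (a b c d : R) :
  a \in A -> b \in A -> c \in A -> d \in A -> (a + b, c + d) \in sumgrid A.
Proof.
by move=> aA bA cA dA; apply/allpairsP; exists (a + b, c + d); split=> //;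
  apply: in_imfset2.
Qed.

Lemma ratioset_gt0 (R : realFieldType) (A : {fset R}) (l : R) :
  (forall a, a \in A -> 0 < a) -> l \in ratioset A -> 0 < l.
Proof. by move=> A_gt0 /imfset2P[a aA [b bA ->]]; rewrite divr_gt0 ?A_gt0. Qed.

(** Double counting: after exchanging the sums, each fixed abscissa [a] meets at least |A| lines,
    since the slopes [b / a] for [b] in [A] are distinct. *)
Lemma leq_sum_card_line (R : realFieldType) (A : {fset R}) :
    (forall a, a \in A -> 0 < a) ->
  (#|` A | ^ 2 <= \sum_(l <- ratioset A) #|` line A l |)%N.
Proof.
move=> A_gt0.
have card_lineE (l : R) : #|` line A l | = (\sum_(a <- A) (l * a \in A)%R)%N.
  rewrite -big_mkcond sum1_count -size_filter; apply: perm_size.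
  rewrite uniq_perm ?filter_uniq ?fset_uniq // => a.
  by rewrite in_line mem_filter andbC.
under eq_bigr do rewrite card_lineE.
rewrite exchange_big /= -mulnn {1}card_fset_sum1 big_distrl /=.
rewrite [leqLHS]big_seq [leqRHS]big_seq; apply: leq_sum => a aA; rewrite mul1n.
rewrite -big_mkcond sum1_count -(size_map (fun b => b / a)) -size_filter.
have a_neq0 : a != 0 by rewrite gt_eqF ?A_gt0.
apply: uniq_leq_size.
  by rewrite map_inj_uniq ?fset_uniq //; apply/mulIf; rewrite invr_eq0.
move=> _ /mapP[b bA ->]; rewrite mem_filter divfK // bA.
exact: in_imfset2.
Qed.

(** The points (a, l a) and (b, m b) are linearly independent directions, so their sum determines
    both. The half-open band keeps consecutive bands disjoint. *)
Lemma leq_card_band (R : realFieldType) (A : {fset R}) (l m : R) :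
    (forall a, a \in A -> 0 < a) -> l < m ->
  (#|` line A l | * #|` line A m | <=
     count [pred p : R * R | (l * p.1 <= p.2 < m * p.1)%R] (sumgrid A))%N.
Proof.
move=> A_gt0 lm; apply: (leq_mul_count (f := fun a b => (a + b, l * a + m * b))).
  move=> a b; rewrite !in_line => /andP[aA laA] /andP[bA mbA].
  rewrite mem_sumgrid //=; have a0 := A_gt0 _ aA; have b0 := A_gt0 _ bA.
  by rewrite !mulrDr lerD2l ltrD2r ler_wpM2r ?ltr_pM2r // ltW.
move=> a b a' b' [e1 e2].
have ea : a = a' + b' - b by rewrite -e1 addrK.
(* Eliminating [a] from the 2 by 2 system leaves its determinant [m - l], which is nonzero. *)
have /eqP : (m - l) * (b - b') = 0 by move: e2; rewrite ea => e2; lra.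
rewrite mulf_eq0 !subr_eq0 (gt_eqF lm) /= => /eqP eb.
by rewrite ea eb addrK.
Qed.

(** With [c] the minimum of [A], add (c, l b) to (a, l a): since [c <= b], the sum is not below the
    line. Its abscissa gives [a], then its ordinate gives [b]. *)
Lemma leq_card_top (R : realFieldType) (A : {fset R}) (l : R) :
    (forall a, a \in A -> 0 < a) -> 0 < l ->
  (#|` line A l | ^ 2 <=
     count [pred p : R * R | (l * p.1 <= p.2)%R] (sumgrid A))%N.
Proof.
move=> A_gt0 l0; have [->|[a0 a0A]] := fset_0Vmem A.
  by rewrite (_ : line _ _ = fset0) ?cardfs0 //; apply/fsetP=> a; rewrite !inE.
have [c cA c_min] : exists2 c, c \in A & forall a, a \in A -> c <= a.
  have [c _ c_min] := arg_minP (fun a : A => val a) (isT : predT [` a0A]%fset).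
  by exists (val c) => [|a aA]; [exact: valP | exact: (c_min [` aA]%fset)].
rewrite -mulnn; apply: (leq_mul_count (f := fun a b => (a + c, l * a + l * b))).
  move=> a b; rewrite !in_line => /andP[aA laA] /andP[bA lbA].
  by rewrite mem_sumgrid //= mulrDr lerD2l ler_pM2l ?c_min.
by move=> a b a' b' [/addIr -> /addrI/(mulfI (lt0r_neq0 l0)) ->].
Qed.

(** Induction on the increasing slopes, ending at the steepest line. The popularity threshold is the
    fraction t / k, with denominators cleared to stay in [nat]. *)
Lemma leq_sum_card_popular (R : realFieldType) (A : {fset R}) (t k : nat) (l : R)
    (s : seq R) :
    (forall a, a \in A -> 0 < a) -> 0 < l ->
    (forall m, m \in l :: s -> (t <= k * #|` line A m |)%N) ->
    path <%R l s ->
  (t * (\sum_(m <- l :: s) #|` line A m |) <=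
     k * count [pred p : R * R | (l * p.1 <= p.2)%R] (sumgrid A))%N.
Proof.
move=> A_gt0; elim: s l => [|m s IHs] l l0 pop.
  move=> _; rewrite big_seq1; have := leq_card_top A_gt0 l0.
  by have := pop l (mem_head _ _); nia.
move=> /= /andP[lm ms]; rewrite big_cons mulnDr.
have popm : (t <= k * #|` line A m |)%N by apply: pop; rewrite !inE eqxx orbT.
have upper := IHs m (lt_trans l0 lm)
  (fun n ns => pop n (mem_behead (s := l :: _) ns)) ms.
have band := leq_card_band A_gt0 lm.
set cu := count _ _ in upper; set cb := count _ _ in band.
set cl := count _ _.
(* The region above slope [l] is the disjoint union of the band from [l] to [m] and the region above
   [m]; covering it uses that grid abscissas are positive. *)
have <- : (cb + cu = cl)%N.
  rewrite /cb /cu /cl -count_predUI [X in (_ + X)%N](_ : _ = 0%N).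
    rewrite addn0; apply: eq_in_count => _ /allpairsP[[x y] [/= xS _ ->]] /=.
    have x0 : 0 < x.
      by have /imfset2P[a aA [b bA ->]] := xS; rewrite addr_gt0 ?A_gt0.
    have lmx : l * x < m * x by rewrite ltr_pM2r.
    case: (leP (m * x) y) => [/(lt_le_trans lmx)/ltW ->|]; first by rewrite orbT.
    by rewrite orbF andbT.
  apply/eqP; rewrite -leqn0 leqNgt -has_count; apply/hasPn => p _ /=.
  by rewrite ltNge -andbA andNb andbF.
rewrite mulnDr leq_add //; apply: leq_trans (leq_mul (leqnn k) band).
by rewrite mulnC mulnCA leq_mul.
Qed.

(** The 4 is 2 * 2: one factor from keeping only half of the points, one from the threshold N^2 / (2
    q). *)
Lemma card_sumset_ratioset (R : realFieldType) (A : {fset R}) :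
    (forall a, a \in A -> 0 < a) ->
  (#|` A | ^ 4 <= 4 * #|` sumset A | ^ 2 * #|` ratioset A |)%N.
Proof.
move=> A_gt0.
have [A0|A_neq0] := eqVneq #|` A | 0%N; first by rewrite A0.
set N := #|` A |; set q := #|` ratioset A |.
pose pop l := (N ^ 2 <= 2 * q * #|` line A l |)%N.
have half : (N ^ 2 <= 2 * \sum_(l <- ratioset A | pop l) #|` line A l |)%N.
  have := leq_sum_card_line A_gt0; rewrite (bigID pop) /= -/N => total.
  (* At most [q] unpopular lines, each with fewer than N^2 / (2 q) points, carry at most N^2 / 2
     points together. *)
  have rare : (2 * q * (\sum_(l <- ratioset A | ~~ pop l) #|` line A l |) <=
      q * N ^ 2)%N.
    rewrite big_distrr /= /q card_fset_sum1 big_distrl /=.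
    rewrite [leqRHS](bigID pop) /=; apply: leq_trans (leq_addl _ _).
    by apply: leq_sum => l; rewrite mul1n -ltnNge -card_fset_sum1 => /ltnW.
  have q_gt0 : (0 < q)%N.
    rewrite lt0n; apply: contraNneq A_neq0 => /cardfs0_eq Q0.
    move: (leq_sum_card_line A_gt0).
    by rewrite Q0 big_seq_fset0 leqn0 expn_eq0 andbT.
  move: rare; rewrite -mulnA mulnCA leq_pmul2l // => rare.
  rewrite -(leq_add2r (N ^ 2)) addnn -mul2n.
  by apply: leq_trans (leq_mul (leqnn 2) total) _; rewrite mulnDr leq_add2l.
pose s := sort <=%R [seq l <- ratioset A | pop l].
have s_sorted : sorted <%R s by rewrite sort_lt_sorted filter_uniq ?fset_uniq.
have sumE : (\sum_(l <- ratioset A | pop l) #|` line A l | =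
    \sum_(l <- s) #|` line A l |)%N.
  by rewrite -big_filter; apply: perm_big; rewrite perm_sym perm_sort.
have mem_s l : l \in s -> pop l && (l \in ratioset A).
  by rewrite mem_sort mem_filter.
case: s s_sorted mem_s sumE => [|l s] s_sorted mem_s sumE.
  by move: half; rewrite sumE big_nil muln0 leqn0 expn_eq0 (negPf A_neq0).
have /andP[_ lA] := mem_s l (mem_head _ _).
have := leq_sum_card_popular A_gt0 (ratioset_gt0 A_gt0 lA)
  (fun m ms => proj1 (andP (mem_s m ms))) s_sorted.
(* The region above the least popular slope is bounded by the whole grid. *)
have := count_size [pred p : R * R | (l * p.1 <= p.2)%R] (sumgrid A).
rewrite size_sumgrid -sumE -mulnA => grid pops.
rewrite -[4%N]/(2 + 2)%N expnD; apply: leq_trans (leq_mul (leqnn _) half) _.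
rewrite mulnCA -[(2 + 2)%N]/(2 * 2)%N -[leqRHS]mulnA -[leqRHS]mulnA leq_pmul2l //.
by apply: leq_trans pops _; rewrite leq_pmul2l // mulnC leq_mul.
Qed.

Theorem theorem1 (R : realType) (A : {fset R})
    (A_gt0 : forall a : R, a \in A -> 0 < a) :
  (#|` A |%:R ^+ 4 / 4 <= #|` sumset A |%:R ^+ 2 * #|` ratioset A |%:R :> R) /\
  (#|` A |%:R `^ (4 / 3) / 2 <=
     Num.max #|` sumset A |%:R #|` ratioset A |%:R :> R).
Proof.
have lower : #|` A |%:R ^+ 4 / 4 <=
    #|` sumset A |%:R ^+ 2 * #|` ratioset A |%:R :> R.
  by have := card_sumset_ratioset A_gt0; rewrite -(ler_nat R) natrX 2!natrM natrX; lra.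
split=> //; set M := Num.max _ _.
have M0 : 0 <= M by rewrite le_max ler0n.
have MS : #|` sumset A |%:R <= M by rewrite le_max lexx.
have MQ : #|` ratioset A |%:R <= M by rewrite le_max lexx orbT.
have N4 : (#|` A |%:R `^ (4 / 3)) ^+ 3 = #|` A |%:R ^+ 4 :> R.
  by rewrite -powR_mulrn ?powR_ge0 // -powRrM divfK ?pnatr_eq0 // powR_mulrn ?ler0n.
(* Cubing reduces the claim to N^4 / 8 <= M^3, which follows with room to spare from N^4 / 4 <= M^2
   * M. *)
rewrite -(@ler_pXn2r _ 3) ?nnegrE ?divr_ge0 ?powR_ge0 // expr_div_n N4.
apply: (@le_trans _ _ (#|` A |%:R ^+ 4 / 4)).
  by have : 0 <= #|` A |%:R ^+ 4 :> R by [rewrite exprn_ge0]; lra.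
rewrite (le_trans lower) // [leRHS]exprSr ler_pM ?exprn_ge0 ?ler0n //.
by rewrite ler_pXn2r ?nnegrE ?ler0n.
Qed.
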